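(* Let $\Phi\in\mathcal{E}_0(I)$. Let $f:I\to\mathbb{R}$ be a function which admits a $\Phi$-convex minorant (i.e., there is a $\Phi$-convex function $g:I\to\mathbb{R}$ with $g\leq f$) and define the sequence $f_n:I\to\mathbb{R}$ by $$f_1:=f,\qquad f_{n+1}:=\underline{C}_\Phi(f_n)\qquad(n\in\mathbb{N}).$$ Then the sequence $(f_n)$ is pointwise decreasing and its (pointwise) limit function is the largest $\Phi$-convex function which is smaller than or equal to $f$.
   Context: $I\subseteq\mathbb{R}$ is a nonempty open interval and $\ell(I)\in(0,\infty]$ is its length. $\mathcal{E}(I)$ is the set of all functions $\Phi:[0,\ell(I))\to[0,\infty)$ (called error functions), and $\mathcal{E}_0(I)$ is the set of those $\Phi\in\mathcal{E}(I)$ with $\Phi(0)=0$. A function $f:I\to\mathbb{R}$ is called $\Phi$-convex if for all $x,y\in I$ and $t\in[0,1]$, $$f(tx+(1-t)y)\leq tf(x)+(1-t)f(y)+t\Phi((1-t)|x-y|)+(1-t)\Phi(t|x-y|).$$ For $f:I\to\mathbb{R}$, the function $\underline{C}_\Phi(f):I\to[-\infty,\infty)$ is defined by $$\underline{C}_\Phi(f)(u):=\inf\big\{t\big(f(x)+\Phi((1-t)|y-x|)\big)+(1-t)\big(f(y)+\Phi(t|y-x|)\big) : x,y\in I,\ t\in[0,1],\ u=tx+(1-t)y\big\}.$$ ''Decreasing'' is meant in the non-strict sense, $\mathbb{N}=\{1,2,\dots\}$. *)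

(* Defs.v *)
From mathcomp Require Import all_boot all_order all_algebra.
From mathcomp Require Import all_classical all_reals all_analysis.

Set Implicit Arguments.
Unset Strict Implicit.
Unset Printing Implicit Defensive.

Import Order.TTheory GRing.Theory Num.Theory.
Import numFieldNormedType.Exports.

Local Open Scope classical_set_scope.
Local Open Scope ring_scope.

(* Functions on I, and error functions on [0, l(I)), are represented by total
   functions R -> R whose values outside these domains are irrelevant: every
   notion below only constrains or evaluates them inside. *)

Definition open_interval (R : realType) (I : set R) : Prop :=
  [/\ I !=set0, is_interval I & open I].

Definition length (R : realType) (I : set R) : \bar R := lebesgue_measure I.

Definition error_function (R : realType) (I : set R) (Phi : R -> R) : Prop :=
  forall s : R, 0 <= s -> (s%:E < length I)%E -> 0 <= Phi s.

Definition error_function0 (R : realType) (I : set R) (Phi : R -> R) : Prop :=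
  error_function I Phi /\ Phi 0 = 0.

Definition Phi_convex (R : realType) (I : set R) (Phi f : R -> R) : Prop :=
  forall x y t : R, I x -> I y -> 0 <= t <= 1 ->
    f (t * x + (1 - t) * y) <=
      t * f x + (1 - t) * f y
      + t * Phi ((1 - t) * `|x - y|) + (1 - t) * Phi (t * `|x - y|).

Definition minorant (R : realType) (I : set R) (g f : R -> R) : Prop :=
  forall x : R, I x -> g x <= f x.

Definition lower_C (R : realType) (I : set R) (Phi f : R -> R) (u : R) :
    \bar R :=
  ereal_inf [set z : \bar R | exists x y t : R,
    [/\ I x, I y, 0 <= t <= 1, u = t * x + (1 - t) * y &
      z = (t * (f x + Phi ((1 - t) * `|y - x|))
           + (1 - t) * (f y + Phi (t * `|y - x|)))%:E]].

(* lower_C_seq I Phi f n is the function f_{n+1} of the sequence f_1 = f,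
   f_{n+1} = lower_C f_n. The junk value of [fine] is harmless only where
   lower_C is finite, which therefore has to be asserted separately. *)
Fixpoint lower_C_seq (R : realType) (I : set R) (Phi f : R -> R) (n : nat) :
    R -> R :=
  if n is m.+1 then fun u => fine (lower_C I Phi (lower_C_seq I Phi f m) u)
  else f.

Definition largest_Phi_convex_minorant (R : realType) (I : set R)
    (Phi f h : R -> R) : Prop :=
  [/\ Phi_convex I Phi h, minorant I h f &
    forall g : R -> R, Phi_convex I Phi g -> minorant I g f -> minorant I g h].

(* Main.v *)
Require Import Defs.
From mathcomp Require Import all_boot all_order all_algebra.
From mathcomp Require Import all_classical all_reals all_analysis.
From mathcomp Require Import ring lra.
Import Order.TTheory GRing.Theory Num.Theory.
Import numFieldNormedType.Exports.
Local Open Scope classical_set_scope.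
Local Open Scope ring_scope.

(** A Phi-convex [g] is a function lying below its own [lower_C]; since
    [lower_C] is monotone, a Phi-convex minorant of [f] is still a minorant of
    [lower_C f], hence of every iterate ([minorant_lower_C_seq]).  In the other
    direction, the trivial decomposition [u = 1 * u + 0 * u], together with
    [Phi 0 = 0], gives [lower_C f <= f] ([lower_C_le_self]).  So at each point
    of the interval the iterates are real, decrease, and are bounded below by
    the value of the given minorant; they therefore converge to some [h].

    The limit is above every Phi-convex minorant because each iterate is.  It
    is itself Phi-convex because one step of the iteration says exactly that
      f_{n+1} (t x + (1 - t) y) <= t f_n x + (1 - t) f_n y + error
    with an error that does not depend on [n], and this survives the passage
    to the limit, the shift of the index being harmless as the left-hand side
    is at least [h (t x + (1 - t) y)]. *)

Lemma is_interval_conv (R : realType) (I : set R) (x y t : R) :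
  is_interval I -> I x -> I y -> 0 <= t <= 1 -> I (t * x + (1 - t) * y).
Proof.
move=> itvI Ix Iy /andP[t0 t1].
have [xy|yx] := leP x y.
- by apply: (itvI x y) => //; apply/andP; split; nra.
- by apply: (itvI y x) => //; apply/andP; split; nra.
Qed.

(** The weights are distributed as in the definition of Phi-convexity, which
    differs from the one used in [lower_C] by a factorization and by the
    orientation of [x - y]. *)
Lemma lower_C_conv_le (R : realType) (I : set R) (Phi f : R -> R) (x y t : R) :
  I x -> I y -> 0 <= t <= 1 ->
  (lower_C I Phi f (t * x + (1 - t) * y) <=
   (t * f x + (1 - t) * f y
    + t * Phi ((1 - t) * `|x - y|) + (1 - t) * Phi (t * `|x - y|))%:E)%E.
Proof.
move=> Ix Iy t01; apply: ereal_inf_lbound; exists x, y, t.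
by split => //; congr EFin; rewrite (distrC y x); ring.
Qed.

Lemma lower_C_le_self (R : realType) (I : set R) (Phi f : R -> R) (u : R) :
  Phi 0 = 0 -> I u -> (lower_C I Phi f u <= (f u)%:E)%E.
Proof.
move=> Phi0 Iu.
have := @lower_C_conv_le R I Phi f u u 1 Iu Iu.
rewrite !subrr !mul0r Phi0 mulr0 !addr0 !mul1r.
by apply; rewrite ler01 lexx.
Qed.

Lemma Phi_convex_minorant_le_lower_C (R : realType) (I : set R)
    (Phi f g : R -> R) (u : R) :
  Phi_convex I Phi g -> minorant I g f -> ((g u)%:E <= lower_C I Phi f u)%E.
Proof.
move=> gconv gf; apply: le_ereal_inf_tmp => _ [x [y [t [Ix Iy t01 -> ->]]]].
rewrite lee_fin; apply: (le_trans (gconv x y t Ix Iy t01)).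
have /andP[t0 t1] := t01.
have tgf : t * g x <= t * f x by exact: ler_wpM2l (gf x Ix).
have tgf' : (1 - t) * g y <= (1 - t) * f y.
  by apply: ler_wpM2l (gf y Iy); rewrite subr_ge0.
by rewrite (distrC y x); lra.
Qed.

Lemma lower_C_fin_num (R : realType) (I : set R) (Phi f g : R -> R) (u : R) :
  Phi 0 = 0 -> Phi_convex I Phi g -> minorant I g f -> I u ->
  lower_C I Phi f u \is a fin_num.
Proof.
move=> Phi0 gconv gf Iu; rewrite fin_numElt; apply/andP; split.
- apply: (lt_le_trans (ltNyr (g u))).
  exact: Phi_convex_minorant_le_lower_C.
- apply: (le_lt_trans _ (ltry (f u))).
  exact: lower_C_le_self.
Qed.

Lemma minorant_lower_C_seq (R : realType) (I : set R) (Phi f g : R -> R)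
    (n : nat) :
  Phi 0 = 0 -> Phi_convex I Phi g -> minorant I g f ->
  minorant I g (lower_C_seq I Phi f n).
Proof.
move=> Phi0 gconv gf; elim: n => [//|n gfn] u Iu.
rewrite -lee_fin /= fineK; last exact: (@lower_C_fin_num _ _ _ _ g).
exact: Phi_convex_minorant_le_lower_C.
Qed.

Theorem theorem5p7 (R : realType) (I : set R) (Phi f : R -> R)
    (hI : open_interval I) (hPhi : error_function0 I Phi)
    (hf : exists g : R -> R, Phi_convex I Phi g /\ minorant I g f) :
  [/\ forall (n : nat) (u : R), I u ->
        lower_C I Phi (lower_C_seq I Phi f n) u \is a fin_num,
      forall u : R, I u ->
        nonincreasing_seq (fun n : nat => lower_C_seq I Phi f n u) &
      exists h : R -> R,
        (forall u : R, I u ->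
           (fun n : nat => lower_C_seq I Phi f n u) @ \oo --> h u) /\
        largest_Phi_convex_minorant I Phi f h].
Proof.
have [_ itvI _] := hI; have [_ Phi0] := hPhi; have [g [gconv gf]] := hf.
set F := lower_C_seq I Phi f.
have minF k (kconv : Phi_convex I Phi k) (kf : minorant I k f) n :
  minorant I k (F n) by exact: minorant_lower_C_seq.
have finF n u (Iu : I u) : lower_C I Phi (F n) u \is a fin_num.
  by apply: (@lower_C_fin_num _ _ _ _ g) => //; exact: minF.
have FS n u (Iu : I u) : (F n.+1 u)%:E = lower_C I Phi (F n) u.
  by rewrite /F /= fineK//; exact: finF.
have decF u (Iu : I u) : nonincreasing_seq (fun n => F n u).
  apply/nonincreasing_seqP => n.
  by rewrite -lee_fin FS//; exact: lower_C_le_self.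
have cvgF u (Iu : I u) : cvgn (fun n => F n u).
  apply: nonincreasing_is_cvgn; first exact: decF.
  by exists (g u) => _ [n _ <-]; exact: minF.
split => //; exists (fun u => limn (fun n => F n u)); split => //.
have limF_le n u (Iu : I u) : limn (fun n => F n u) <= F n u.
  exact: (nonincreasing_cvgn_ge (decF u Iu) (cvgF u Iu)).
split.
- move=> x y t Ix Iy t01; set u := t * x + (1 - t) * y.
  have Iu : I u by exact: is_interval_conv.
  set e1 := t * Phi _; set e2 := (1 - t) * Phi _.
  apply: (@cvgr_to_ge _ \oo _ _
    (fun n => t * F n x + (1 - t) * F n y + e1 + e2)).
    apply: cvgD; last exact: cvg_cst.
    apply: cvgD; last exact: cvg_cst.
    by apply: cvgD; apply: cvgMl_tmp; exact: cvgF.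
  apply: nearW => n; apply: (le_trans (limF_le n.+1 u Iu)).
  by rewrite -lee_fin FS//; exact: lower_C_conv_le.
- by move=> u Iu; exact: (limF_le 0).
- move=> k kconv kf u Iu; apply: limr_ge; first exact: cvgF.
  by apply: nearW => n; exact: minF.
Qed.
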